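(* Let $\lambda\ge 0$, let $T$ be Poisson distributed with parameter $\lambda$, and let $N\ge 1$. Let $L$ be the set of convex combinations of the distributions of $0T,1T,2T,\dots,NT$. Then $L$ is good.
   Context: $P(\mathbb{R})$ denotes the set of Borel probability measures on $\mathbb{R}$, with the $\sigma$-algebra generated by the maps $\mu\mapsto\mu(B)$, $B\subset\mathbb{R}$ Borel; $P(P(\mathbb{R}))$ is the set of probability measures on $P(\mathbb{R})$. The Poisson distribution with parameter $0$ is understood as $\delta_0$. For $\Theta\in P(P(\mathbb{R}))$, a sequence $X=(X_j)_{j\in\mathbb{N}}$ of real random variables is iid-$\Theta$ if $\mathbb{P}(X\in B)=\int\theta^{\mathbb{N}}(B)\,d\Theta(\theta)$ for all Borel $B\subset\mathbb{R}^{\mathbb{N}}$, where $\theta^{\mathbb{N}}$ is the infinite product measure. A measurable set $L\subset P(\mathbb{R})$ is called good if the following holds: whenever $\Theta_1,\Theta_2\in P(P(\mathbb{R}))$ are concentrated on $L$, $X$ is iid-$\Theta_1$, $Y$ is iid-$\Theta_2$, and $\sum_{j=1}^n X_j$ and $\sum_{j=1}^n Y_j$ have the same distribution for every $n\ge 1$, then $\Theta_1=\Theta_2$. *)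

(* Defs.v *)
From mathcomp Require Import all_boot all_order all_algebra.
From mathcomp Require Import all_classical all_reals all_analysis.
From mathcomp Require Import measurable_realfun.

Set Implicit Arguments.
Unset Strict Implicit.
Unset Printing Implicit Defensive.

Import Order.TTheory GRing.Theory Num.Theory.
Import numFieldNormedType.Exports.

Local Open Scope classical_set_scope.
Local Open Scope ring_scope.

(* A [probability] is a function on all subsets, whose values off the
   sigma-algebra are arbitrary; hence two of them represent the same probability
   measure when they agree on the measurable sets, and Leibniz equality would be
   too strong. *)
Definition same_prob d (T : measurableType d) (R : realType)
    (mu nu : probability T R) : Prop :=
  forall A, measurable A -> mu A = nu A.

(* The sigma-algebra of [pprobability] is generated by the sets
   {mu | mu B < r} with B Borel and r in [0, 1], i.e., by the evaluation maps
   mu |-> mu B. *)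
Definition PR (R : realType) := pprobability R R.

Definition PPR (R : realType) := probability (PR R) R.

(* Real sequences with the Borel sets of the product topology. *)
Definition realseq (R : realType) :=
  g_sigma_algebraType (@open {ptws nat -> R}).

(* [Q] is the infinite product measure theta^N, i.e., the (unique) Borel
   probability measure on sequences with the product values on the measurable
   rectangles of finite rank. *)
Definition is_infinite_product (R : realType) (theta : PR R)
    (Q : probability (realseq R) R) : Prop :=
  forall (n : nat) (B : nat -> set R), (forall i, measurable (B i)) ->
    Q [set x : nat -> R | forall i, (i < n)%N -> B i (x i)] =
    (\prod_(i < n) theta (B i))%E.

(* The family [prodm] is unique on Borel sets, and it exists by Kolmogorov's
   extension theorem. *)
Definition iid (R : realType) (Theta : PPR R) d (Omega : measurableType d)
    (P : probability Omega R) (X : nat -> {RV P >-> R}) : Prop :=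
  exists2 prodm : PR R -> probability (realseq R) R,
    forall theta, is_infinite_product theta (prodm theta) &
    forall B : set (realseq R), measurable B ->
      P [set w | B (fun j => X j w)] = (\int[ Theta ]_t prodm t B)%E.

Definition good (R : realType) (L : set (PR R)) : Prop :=
  measurable L /\
  forall (Theta1 Theta2 : PPR R), Theta1 L = 1%E -> Theta2 L = 1%E ->
  forall (d1 : measure_display) (Omega1 : measurableType d1)
    (P1 : probability Omega1 R) (X : nat -> {RV P1 >-> R})
    (d2 : measure_display) (Omega2 : measurableType d2)
    (P2 : probability Omega2 R) (Y : nat -> {RV P2 >-> R}),
  iid Theta1 X -> iid Theta2 Y ->
  (forall n, (1 <= n)%N ->
    same_prob (distribution P1 (\sum_(j < n) X j))
              (distribution P2 (\sum_(j < n) Y j))) ->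
  same_prob Theta1 Theta2.

(* The law is carried from [nat] to [R]. [poisson_prob] does not depend on its
   second argument, and for [lambda = 0] it is the Dirac measure at 0. *)
Definition poisson_distributed (R : realType) (lambda : R)
    d (Omega : measurableType d) (P : probability Omega R)
    (T : {RV P >-> R}) : Prop :=
  forall B : set R, measurable B ->
    distribution P T B = pushforward (poisson_prob lambda 0) (fun n => n%:R : R) B.

Definition convex_combination d (T : measurableType d) (R : realType)
    (m : nat) (nu : 'I_m -> probability T R) : set (pprobability T R) :=
  [set theta : probability T R | exists w : 'I_m -> R,
    [/\ forall k, 0 <= w k, \sum_(k < m) w k = 1 &
        forall B, measurable B ->
          theta B = (\sum_(k < m) (w k)%:E * nu k B)%E]].

(* Main.v *)
(* Let nu_k be the law of kT. A theta in L is sum_k w_k nu_k, and for lambda > 0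
   the atoms of theta at 0, ..., N determine w linearly. The moment generating
   function of X_1 + ... + X_n at s is the Theta-integral of
   (sum_k w_k exp(lambda (e^(sk) - 1)))^n; expanding the power gives the mixed
   moments of w of degree n against the functions
   exp(lambda (p(e^s) - n)), where p = sum_k m_k X^k runs over the distinct
   polynomials with m_0 + ... + m_N = n. These are linearly independent, by
   comparing growth as s goes to infinity, so the laws of the sums determine all
   mixed moments of w under Theta. Moments determine the law of theta: a
   half-space indicator [theta B < r] is a bounded pointwise limit of polynomials
   in w, because (1 - v^n)^(n 2^n) tends to the indicator of [v < 1/2] on [0, 1].
   For lambda = 0 the set L consists of the Dirac mass at 0 only. *)
Require Import Defs.
From mathcomp Require Import all_boot all_order all_algebra.
From mathcomp Require Import all_classical all_reals all_analysis.
From mathcomp Require Import measurable_realfun.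
From mathcomp Require Import ring lra.
From mathcomp Require polyrcf.
Import Order.TTheory GRing.Theory Num.Theory.
Import numFieldNormedType.Exports.
Import HBNNSimple.
Local Open Scope classical_set_scope.
Local Open Scope ring_scope.

Set Implicit Arguments.
Unset Strict Implicit.
Unset Printing Implicit Defensive.

(** * Bounded polynomial approximation of a step function *)

(** Bernoulli's inequality bounds the power below by 1 - n (2v)^n when v < 1/2. When v >= 1/2 it
    gives (1 + v^n)^(n 2^n) >= 1 + n, and since (1 - v^n)(1 + v^n) <= 1 the power is at most 1/(1 +
    n). *)
Lemma step_poly_cvg (R : realType) (v : R) : 0 <= v <= 1 ->
  (1 - v ^+ n) ^+ (n * 2 ^ n)%N @[n --> \oo] --> ((v < 2^-1)%R%:R : R).
Proof.
move=> /andP[v0 v1].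
have vn1 n : 0 <= 1 - v ^+ n by rewrite subr_ge0 exprn_ile1.
have bern (x : R) (k : nat) : -1 <= x -> 1 + k%:R * x <= (1 + x) ^+ k.
  move=> x1; elim: k => [|k IH]; first by rewrite mul0r addr0 expr0.
  rewrite exprS; apply: le_trans (ler_wpM2l _ IH); last lra.
  rewrite -natr1 mulrDl mul1r mulrDr mulr1 mulrDl mul1r.
  have : 0 <= k%:R * x ^+ 2 by rewrite mulr_ge0 ?sqr_ge0.
  rewrite expr2; lra.
have geo (x : R) : 0 <= x < 1 -> n%:R * x ^+ n @[n --> \oo] --> (0 : R).
  (* As the mean of 1 and x, [y] satisfies x <= y^2 and y < 1. Hence n x^n <= (n y^n) y^n, where
     Bernoulli's inequality for 1/y bounds n y^n by 1/(1/y - 1). *)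
  move=> /andP[x0 x1]; pose y := (1 + x) / 2.
  have y0 : 0 < y by rewrite /y; lra.
  have xy : x <= y ^+ 2.
    by rewrite -subr_ge0 (_ : _ - _ = ((1 - x) / 2) ^+ 2) ?sqr_ge0// /y; field.
  have h0 : 0 < y^-1 - 1 by rewrite subr_gt0 invf_gt1// /y; lra.
  apply: (@squeeze_cvgr _ _ _ _ (fun=> 0) (fun n => (y^-1 - 1)^-1 * y ^+ n)).
  - apply: nearW => n; rewrite mulr_ge0 ?exprn_ge0//=.
    apply: (@le_trans _ _ (n%:R * (y ^+ 2) ^+ n)).
      by rewrite ler_wpM2l// lerXn2r// nnegrE ?sqr_ge0.
    rewrite expr2 exprMn mulrA; apply: ler_wpM2r; first by rewrite exprn_ge0 ?ltW.
    rewrite -ler_pdivlMr ?exprn_gt0// -exprVn ler_pdivlMl//.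
    have := bern _ n (ltac:(lra) : -1 <= y^-1 - 1).
    by rewrite [1 + (_ - _)]addrC subrK mulrC; apply: le_trans; rewrite lerDr.
  - exact: cvg_cst.
  - by apply: cvg_geometric; rewrite ger0_norm ?ltW// /y; lra.
have [vlt|vge] := ltP v 2^-1.
  apply: (@squeeze_cvgr _ _ _ _ (fun n => 1 - n%:R * (2 * v) ^+ n) (fun=> 1)).
  - apply: nearW => n; apply/andP; split; last by rewrite exprn_ile1// gerBl exprn_ge0.
    have := bern (- v ^+ n) (n * 2 ^ n)%N; rewrite mulrN natrM natrX -mulrA -exprMn.
    by apply; rewrite lerN2 exprn_ile1.
  - rewrite -[X in _ --> X]subr0; apply: cvgB; first exact: cvg_cst.
    by apply: geo; lra.
  - exact: cvg_cst.
apply: (@squeeze_cvgr _ _ _ _ (fun=> 0) (fun n => (1 + n%:R)^-1)).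
- apply: nearW => n; rewrite exprn_ge0//=.
  rewrite -[leRHS]mul1r ler_pdivlMr; last by rewrite ltr_wpDr.
  have h : 1 + n%:R <= (1 + v ^+ n) ^+ (n * 2 ^ n).
    apply: le_trans (bern _ _ _); last by apply: le_trans (exprn_ge0 _ v0); lra.
    rewrite lerD2l natrM natrX -mulrA -exprMn ler_peMr// exprn_ege1//; lra.
  apply: le_trans (ler_wpM2l (exprn_ge0 _ (vn1 n)) h) _.
  rewrite -exprMn -subr_sqr expr1n exprn_ile1// ?gerBl ?sqr_ge0// subr_ge0.
  by rewrite -exprM exprn_ile1.
- exact: cvg_cst.
- under eq_fun do rewrite addrC natr1; exact: cvg_harmonic.
Qed.

(** * Linear independence of exponentials of polynomials *)

(** The common value at 1 prevents two distinct members of [S] from differing by a constant, which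
    would make their exponentials proportional. Their difference therefore tends to plus or minus
    infinity. Dividing by the fastest growing exponential with nonzero coefficient and letting s go
    to infinity leaves that coefficient alone, so it is 0, a contradiction. *)
Lemma expR_poly_free (R : realType) (lambda a : R) (S : seq {poly R})
    (c : {poly R} -> R) : 0 < lambda -> uniq S -> {in S, forall p, p.[1] = a} ->
  (forall s, 1 <= s -> \sum_(p <- S) c p * expR (lambda * p.[s]) = 0) ->
  {in S, forall p, c p = 0}.
Proof.
move=> lam0 uS S1 cS0.
have diffP (p q : {poly R}) : p \in S -> q \in S -> p != q ->
    (p - q).[s] @[s --> +oo] --> +oo \/ (q - p).[s] @[s --> +oo] --> +oo.
  move=> pS qS pq.
  have pinf (r : {poly R}) : (1 < size r)%N -> 0 < lead_coef r ->
      r.[s] @[s --> +oo] --> +oo.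
    (* Subtracting the constant [A] keeps the leading coefficient, and a polynomial with positive
       leading coefficient is eventually at least that coefficient. *)
    move=> r1 lr; apply/cvgryPge => A.
    have lrA : lead_coef (r - A%:P) = lead_coef r.
      by rewrite lead_coefDl// size_polyN (leq_ltn_trans (size_polyC_leq1 _)).
    have [|n nP] := polyrcf.poly_pinfty_gt_lc (p := r - A%:P); rewrite ?lrA//.
    near=> s; have /nP : n <= s by near: s; apply: nbhs_pinfty_ge; exact: num_real.
    by rewrite hornerD hornerN hornerC lrA => h; rewrite -subr_ge0 (le_trans (ltW lr)).
  have s1 : (1 < size (p - q)%R)%N.
    rewrite ltnNge; apply/negP => /size1_polyC pqC.
    have : (p - q).[1] = 0 by rewrite hornerD hornerN !S1// subrr.
    by rewrite pqC hornerC => c0; move: pq; rewrite -subr_eq0 pqC c0 eqxx.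
  have := lead_coef_eq0 (p - q); rewrite subr_eq0 (negbTE pq) => /negbT.
  rewrite neq_lt => /orP[l0|l0]; [right|left]; apply: pinf => //.
    by rewrite -opprB size_polyN.
  by rewrite -opprB lead_coefN oppr_gt0.
suff : all (fun p => c p == 0) S by move=> /allP h p /h/eqP.
apply: contraT => /allPn[p0 p0S cp0].
pose S' := [seq p <- S | c p != 0].
have p0S' : p0 \in S' by rewrite mem_filter cp0.
pose dom (q p : {poly R}) := \forall s \near +oo, p.[s] <= q.[s] :> R.
(* Any two members of [S] are comparable near infinity, so a nonempty finite subfamily has a
   greatest one, found by induction on the list. *)
have [q qS' qmax] : exists2 q, q \in S' & {in S', forall p, dom q p}.
  have : {subset S' <= S} by move=> p; rewrite mem_filter => /andP[].
  have : S' != [::] by move: p0S'; case: S'.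
  elim: S' {p0S'} => // p [|p' S2] IH _ sub.
    by exists p; rewrite ?mem_head// => _ /[1!inE]/eqP->; exact: nearW.
  have [||q qs qmax] := IH => //; first by move=> r rs; apply: sub; rewrite inE rs orbT.
  have [->|pq] := eqVneq p q.
    exists q; first by rewrite inE qs orbT.
    move=> r; rewrite inE => /orP[/eqP->|/qmax//]; exact: nearW.
  have pS := sub _ (mem_head _ _).
  have qS : q \in S by apply: sub; rewrite inE qs orbT.
  have [/cvgryPge/(_ 0)|/cvgryPge/(_ 0)] := diffP _ _ pS qS pq => pq0.
    exists p; rewrite ?mem_head// => r; rewrite inE => /orP[/eqP->|/qmax qr].
      exact: nearW.
    near=> s; apply: (@le_trans _ _ q.[s]); near: s => //.
    by apply: filterS pq0 => s; rewrite hornerD hornerN subr_ge0.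
  exists q; first by rewrite inE qs orbT.
  move=> r; rewrite inE => /orP[/eqP->|/qmax//].
  by apply: filterS pq0 => s; rewrite hornerD hornerN subr_ge0.
have qS : q \in S by move: qS'; rewrite mem_filter => /andP[].
have cvg_q : \sum_(p <- S) c p * expR (lambda * (p.[s] - q.[s])) @[s --> +oo] --> c q.
  have -> : c q = \sum_(p <- S) (if p == q then c q else 0).
    by rewrite -big_mkcond -big_filter filter_pred1_uniq// big_seq1.
  rewrite [X in _ --> X]big_seq.
  under eq_cvg do rewrite big_seq.
  apply: cvg_big => [|p pS]; first exact: add_continuous.
  case: eqVneq => [->|pq].
    by under eq_cvg do rewrite subrr mulr0 expR0 mulr1; exact: cvg_cst.
  have [->|cp] := eqVneq (c p) 0.
    by under eq_cvg do rewrite mul0r; exact: cvg_cst.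
  rewrite -(mulr0 (c p)); apply: cvgMl_tmp.
  (* If p - q went to infinity, p would eventually exceed q by 1, against the maximality of [q]; so
     q - p does. *)
  have [|qp] := diffP _ _ pS qS pq.
    move=> /cvgryPge/(_ 1) pq1.
    have /qmax qp : p \in S' by rewrite mem_filter cp.
    have [s] := filter_ex (filterI pq1 qp).
    by move=> [/= + /=]; rewrite hornerD hornerN; lra.
  apply/cvgrPdist_lt => e e0.
  near=> s; rewrite sub0r normrN gtr0_norm ?expR_gt0//.
  rewrite -[ltRHS]lnK// ltr_expR.
  (* This threshold makes the exponent at most ln e - 1, hence the exponential smaller than e. *)
  have : (q - p).[s] >= (1 - ln e) / lambda by near: s; exact: (cvgryPge _).1.
  rewrite ler_pdivrMr// hornerD hornerN mulrC; lra.
have : c q = 0.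
  apply: (cvg_unique _ cvg_q); first exact: norm_hausdorff.
  apply: cvg_near_cst; near=> s.
  transitivity (expR (- (lambda * q.[s])) *
      \sum_(p <- S) c p * expR (lambda * p.[s])).
    rewrite mulr_sumr; apply: eq_bigr => p _.
    by rewrite mulrBr expRD; ring.
  rewrite cS0 ?mulr0//; near: s; apply: nbhs_pinfty_ge; exact: num_real.
by move: qS'; rewrite mem_filter => /andP[/eqP+ _] => /[apply].
Unshelve. all: by end_near.
Qed.

(** The coefficient of X^k in the sum counts the positions carrying the letter k, and the product
    depends on the word only through these counts. *)
Lemma prod_of_sum_Xn (R : numDomainType) (m n : nat) (w : 'I_m -> R)
    (f g : 'I_n -> 'I_m) :
  \sum_i 'X^(f i) = \sum_i 'X^(g i) :> {poly R} ->
  \prod_i w (f i) = \prod_i w (g i).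
Proof.
have E (h : 'I_n -> 'I_m) : \prod_i w (h i) =
    \prod_(k < m) w k ^+ #|[pred i | h i == k]|.
  rewrite (partition_big h predT)//=; apply: eq_bigr => k _.
  rewrite (eq_bigr (fun=> w k)) => [|i /eqP->//].
  by rewrite prodr_const.
move=> fg; rewrite !E; apply: eq_bigr => k _; congr (_ ^+ _); apply/eqP.
have C (h : 'I_n -> 'I_m) : #|[pred i | h i == k]|%:R = (\sum_i 'X^(h i) : {poly R})`_k.
  rewrite coef_sum -sum1_card natr_sum big_mkcond; apply: eq_bigr => i _.
  by rewrite coefXn inE eq_sym -val_eqE /=; case: eqP.
by rewrite -(eqr_nat R) !C fg.
Qed.

(** * Functions with equal integrals under two laws *)

(** Measurability and boundedness on [D] travel with the equality, so that linearity and dominated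
    convergence preserve the property. *)
Definition same_integral d (T : measurableType d) (R : realType)
    (mu nu : probability T R) (D : set T) (f : T -> R) : Prop :=
  [/\ measurable_fun D f, exists M : R, forall x, D x -> `|f x| <= M &
      (\int[mu]_(x in D) (f x)%:E = \int[nu]_(x in D) (f x)%:E)%E].

Section same_integral.
Context d (T : measurableType d) (R : realType) (mu nu : probability T R).
Variables (D : set T) (mD : measurable D).

Lemma bounded_integrable (P : probability T R) (f : T -> R) :
  measurable_fun D f -> (exists M : R, forall x, D x -> `|f x| <= M) ->
  P.-integrable D (EFin \o f).
Proof.
move=> mf [M fM]; apply: measurable_bounded_integrable => //.
  by rewrite (le_lt_trans (probability_le1 _ _)) ?ltry.
exists M; split; first exact: num_real.
by move=> y My x Dx; apply: le_trans (fM _ Dx) _; exact: ltW.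
Qed.

Lemma eq_same_integral (f g : T -> R) : (forall x, D x -> f x = g x) ->
  same_integral mu nu D f -> same_integral mu nu D g.
Proof.
move=> fg [mf [M fM] muf]; split.
- by apply: eq_measurable_fun mf => x /set_mem /fg.
- by exists M => x Dx; rewrite -fg ?fM.
- suff E (P : probability T R) :
      (\int[P]_(x in D) (g x)%:E = \int[P]_(x in D) (f x)%:E)%E by rewrite !E.
  by apply: eq_integral => x /set_mem/fg ->.
Qed.

Lemma same_integralD (f g : T -> R) :
  same_integral mu nu D f -> same_integral mu nu D g ->
  same_integral mu nu D (fun x => f x + g x).
Proof.
move=> [mf bf muf] [mg bg mug].
have [M fM] := bf; have [N gN] := bg; split.
- exact: measurable_funD.
- by exists (M + N) => x Dx; rewrite (le_trans (ler_normD _ _))// lerD ?fM ?gN.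
- under eq_integral do rewrite EFinD.
  under [RHS]eq_integral do rewrite EFinD.
  rewrite !integralD//=; last 4 first; try exact: bounded_integrable.
  by rewrite muf mug.
Qed.

Lemma same_integralZ (a : R) (f : T -> R) :
  same_integral mu nu D f -> same_integral mu nu D (fun x => a * f x).
Proof.
move=> [mf bf muf]; have [M fM] := bf; split.
- exact: measurable_funM.
- by exists (`|a| * M) => x Dx; rewrite normrM ler_wpM2l// fM.
- under eq_integral do rewrite EFinM.
  under [RHS]eq_integral do rewrite EFinM.
  rewrite !integralZl//=; last 2 first; try exact: bounded_integrable.
  by rewrite muf.
Qed.

Lemma same_integral_cvg (f_ : nat -> T -> R) (f : T -> R) :
  (forall n, same_integral mu nu D (f_ n)) ->
  (exists M : R, forall n x, D x -> `|f_ n x| <= M) ->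
  (forall x, D x -> f_ n x @[n --> \oo] --> f x) ->
  same_integral mu nu D f.
Proof.
move=> sf [M fM] ff.
have mf : measurable_fun D f.
  by apply: (measurable_fun_cvg (h := f_)) => // n; have [] := sf n.
have cvg_int (P : probability T R) :
    (\int[P]_(x in D) (f_ n x)%:E @[n --> \oo] --> \int[P]_(x in D) (f x)%:E)%E.
  have [|||||//] := @dominated_convergence _ _ _ P D mD
    (fun n x => (f_ n x)%:E) (fun x => (f x)%:E) (fun=> M%:E).
  - by move=> n; apply/measurable_EFinP; have [] := sf n.
  - exact/measurable_EFinP.
  - by apply: aeW => x Dx; apply: cvg_EFin; [exact: nearW|exact: ff].
  - by apply: (@bounded_integrable P (cst M)) => //; exists `|M|.
  - by apply: aeW => x n Dx; rewrite lee_fin fM.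
split => //.
- exists M => x Dx; 
  have fx : `|f_ n x| @[n --> \oo] --> `|f x| by apply: cvg_norm; exact: ff.
  rewrite -(cvg_lim _ fx)//; apply: limr_le; first exact: cvgP fx.
  by apply: nearW => n; exact: fM.
- have := cvg_int mu; have := cvg_int nu.
  have -> : (fun n => \int[mu]_(x in D) (f_ n x)%:E)%E =
            (fun n => \int[nu]_(x in D) (f_ n x)%:E)%E.
    by apply/funext => n; have [] := sf n.
  by move=> /cvg_lim <-// /cvg_lim <-.
Qed.

End same_integral.

(** * From equal mixed moments to equal laws *)

Section moments.
Context d (T : measurableType d) (R : realType) (mu nu : probability T R).
Variables (D : set T) (mD : measurable D) (m : nat) (w : 'I_m -> T -> R).
Hypothesis mw : forall k, measurable_fun D (w k).
Hypothesis w01 : forall k x, D x -> 0 <= w k x <= 1.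

(** Quantifying over all monomials in the weights makes the class of such [f] stable under
    multiplication by each weight, hence by polynomials in the weights. *)
Definition same_moments (f : T -> R) := forall s : seq 'I_m,
  same_integral mu nu D (fun x => f x * \prod_(k <- s) w k x).

Lemma eq_same_moments (f g : T -> R) : (forall x, D x -> f x = g x) ->
  same_moments f -> same_moments g.
Proof.
by move=> fg Mf s; apply: eq_same_integral (Mf s) => x Dx; rewrite fg.
Qed.

Lemma same_momentsD (f g : T -> R) :
  same_moments f -> same_moments g -> same_moments (fun x => f x + g x).
Proof.
move=> Mf Mg s; apply: eq_same_integral (same_integralD mD (Mf s) (Mg s)).
by move=> x _; rewrite mulrDl.
Qed.

Lemma same_momentsZ (a : R) (f : T -> R) :
  same_moments f -> same_moments (fun x => a * f x).
Proof.
move=> Mf s; apply: eq_same_integral (same_integralZ mD a (Mf s)).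
by move=> x _; rewrite mulrA.
Qed.

Lemma same_momentsB (f g : T -> R) :
  same_moments f -> same_moments g -> same_moments (fun x => f x - g x).
Proof.
move=> Mf /(same_momentsZ (-1)) Mg.
by apply: eq_same_moments (same_momentsD Mf Mg) => x _; rewrite mulN1r.
Qed.

Lemma prod_weight_norm (s : seq 'I_m) x : D x -> `|\prod_(k <- s) w k x| <= 1.
Proof.
move=> Dx; rewrite ger0_norm; first by apply: prodr_ile1 => k _; exact: w01.
by apply: prodr_ge0 => k _; have /andP[] := w01 k Dx.
Qed.

Lemma same_moments_cvg (f_ : nat -> T -> R) (f : T -> R) :
  (forall n, same_moments (f_ n)) ->
  (exists M : R, forall n x, D x -> `|f_ n x| <= M) ->
  (forall x, D x -> f_ n x @[n --> \oo] --> f x) ->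
  same_moments f.
Proof.
move=> Mf [M fM] ff s.
apply: (same_integral_cvg mD (fun n => Mf n s)).
  exists M => n x Dx; rewrite normrM -[M]mulr1.
  by rewrite ler_pM// ?fM// prod_weight_norm.
by move=> x Dx; apply: cvgMr_tmp; exact: ff.
Qed.

Lemma same_moments_bounded (f : T -> R) :
  same_moments f -> exists M : R, forall x, D x -> `|f x| <= M.
Proof.
move=> /(_ [::])[_ [M fM] _]; exists M => x Dx.
by have := fM _ Dx; rewrite big_nil mulr1.
Qed.

Lemma same_moments_weight (k : 'I_m) (f : T -> R) :
  same_moments f -> same_moments (fun x => f x * w k x).
Proof.
move=> Mf s; apply: eq_same_integral (Mf (k :: s)) => x _.
by rewrite big_cons mulrA.
Qed.

Lemma same_moments_affine (b : R) (a : 'I_m -> R) (f : T -> R) :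
  same_moments f ->
  same_moments (fun x => f x * (b + \sum_(k < m) a k * w k x)).
Proof.
move=> Mf.
have Msum (r : seq 'I_m) :
    same_moments (fun x => \sum_(k <- r) a k * (f x * w k x)).
  elim: r => [|k r IH].
    by apply: eq_same_moments (same_momentsZ 0 Mf) => x _; rewrite big_nil mul0r.
  apply: eq_same_moments
    (same_momentsD (same_momentsZ (a k) (same_moments_weight k Mf)) IH) => x _.
  by rewrite big_cons.
apply: eq_same_moments (same_momentsD (same_momentsZ b Mf) (Msum _)) => x _.
rewrite mulrDr mulr_sumr [f x * b]mulrC; congr (_ + _).
by apply: eq_bigr => k _; rewrite mulrCA.
Qed.

Lemma same_momentsX (u : T -> R) :
  (forall f, same_moments f -> same_moments (fun x => f x * u x)) ->
  forall (n : nat) f, same_moments f -> same_moments (fun x => f x * u x ^+ n).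
Proof.
move=> Mu n f Mf; elim: n => [|n IH].
  by apply: eq_same_moments Mf => x _; rewrite mulr1.
by apply: eq_same_moments (Mu _ IH) => x _; rewrite exprSr mulrA.
Qed.

(* The affine change of variable sends the threshold r to 1/2 and [0, 1] into
   itself, so that [step_poly_cvg] applies. *)
Lemma same_moments_lt (a : 'I_m -> R) (r : R) (f : T -> R) :
  (forall x, D x -> 0 <= \sum_(k < m) a k * w k x <= 1) -> 0 <= r <= 1 ->
  same_moments f ->
  same_moments (fun x => f x * (\sum_(k < m) a k * w k x < r)%R%:R).
Proof.
move=> a01 /andP[r0 r1] Mf.
pose v x := (2^-1 - r / 4) + \sum_(k < m) a k / 4 * w k x.
have vE x : v x = 2^-1 + (\sum_(k < m) a k * w k x - r) / 4.
  rewrite /v; suff -> : \sum_(k < m) a k / 4 * w k x = (\sum_(k < m) a k * w k x) / 4.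
    by rewrite mulrBl addrAC -addrA.
  by rewrite mulr_suml; apply: eq_bigr => k _; rewrite mulrAC.
have v01 x : D x -> 0 <= v x <= 1.
  by move=> /a01/andP[? ?]; rewrite vE; apply/andP; split; lra.
have Mv n N g : same_moments g ->
    same_moments (fun x => g x * (1 - v x ^+ n) ^+ N).
  apply: same_momentsX => h Mh.
  have Mhv : same_moments (fun x => h x * v x ^+ n).
    by apply: same_momentsX => // g' Mg'; exact: same_moments_affine.
  by apply: eq_same_moments (same_momentsB Mh Mhv) => x _; rewrite mulrBr mulr1.
apply: (same_moments_cvg (f_ := fun n x => f x * (1 - v x ^+ n) ^+ (n * 2 ^ n))).
- by move=> n; exact: Mv.
- have [M fM] := same_moments_bounded Mf.
  exists M => n x Dx; rewrite normrM -[M]mulr1 ler_pM// ?fM//.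
  have /andP[v0 v1] := v01 _ Dx.
  have u0 : 0 <= 1 - v x ^+ n by rewrite subr_ge0 exprn_ile1.
  by rewrite ger0_norm ?exprn_ge0// exprn_ile1// gerBl exprn_ge0.
- move=> x Dx; apply: cvgMl_tmp; have := step_poly_cvg (v01 _ Dx).
  suff -> : (v x < 2^-1)%R = (\sum_(k < m) a k * w k x < r)%R by [].
  by rewrite vE -[ltRHS]addr0 ltrD2l pmulr_llt0 ?subr_lt0.
Qed.

(** Stability is required for every [f] of the class and not just for the constant 1: multiplying by
    two indicators in turn then handles intersections, and the stable sets form a sigma-algebra. *)
Definition moment_stable (A : set T) := forall f, same_moments f ->
  same_moments (fun x => f x * \1_A x).

Lemma moment_stableC (A : set T) : moment_stable A -> moment_stable (~` A).
Proof.
move=> MA f Mf; apply: eq_same_moments (same_momentsB Mf (MA _ Mf)) => x _.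
by rewrite indicC indicE; case: (x \in A); rewrite /= ?mulr0 ?mulr1 ?subrr ?subr0.
Qed.

Lemma moment_stable0 : moment_stable set0.
Proof.
move=> f Mf; apply: eq_same_moments (same_momentsZ 0 Mf) => x _.
by rewrite indic0 mul0r mulr0.
Qed.

Lemma moment_stableI (A B : set T) :
  moment_stable A -> moment_stable B -> moment_stable (A `&` B).
Proof.
move=> MA MB f Mf; apply: eq_same_moments (MB _ (MA _ Mf)) => x _.
by rewrite indicI -mulrA.
Qed.

(** Finite unions come from complements and intersections; their indicators converge pointwise and
    boundedly to that of the countable union. *)
Lemma moment_stable_bigcup (F : nat -> set T) :
  (forall n, moment_stable (F n)) -> moment_stable (\bigcup_n F n).
Proof.
move=> MF f Mf; pose U n := \big[setU/set0]_(i < n) F i.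
have MU n : moment_stable (U n).
  rewrite /U; elim: n => [|n IH]; first by rewrite big_ord0; exact: moment_stable0.
  rewrite big_ord_recr/= -[X in moment_stable X]setCK setCU.
  by apply/moment_stableC/moment_stableI; exact: moment_stableC.
have [M fM] := same_moments_bounded Mf.
apply: (same_moments_cvg (f_ := fun n x => f x * \1_(U n) x)).
- by move=> n; exact: MU.
- exists M => n x Dx; rewrite normrM -[M]mulr1 ler_pM// ?fM//.
  by rewrite indicE; case: (_ \in _); rewrite ?normr1 ?normr0.
- move=> x Dx; apply: cvgMl_tmp; apply: cvg_near_cst.
  rewrite !indicE; case: (pselect ((\bigcup_n F n) x)) => Fx.
    rewrite mem_set//; have [i _ Fi] := Fx; exists i.+1 => // n /= lin.
    rewrite indicE mem_set// /U -bigcup_mkord; by exists i.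
  rewrite memNset//; apply: nearW => n; rewrite indicE memNset// /U -bigcup_mkord.
  by move=> [i _ Fi]; apply: Fx; exists i.
Qed.

(** Equality of the moments puts the constant 1 in the class. Stability of [A] adds its indicator,
    and the empty monomial then compares the masses of [A] within [D]. *)
Lemma moments_determine (G : set (set T)) :
  (forall s : seq 'I_m, \int[mu]_(x in D) (\prod_(k <- s) w k x)%:E =
                        \int[nu]_(x in D) (\prod_(k <- s) w k x)%:E)%E ->
  (forall A, G A -> moment_stable A) ->
  forall A, measurable A -> <<s G >> A -> mu (A `&` D) = nu (A `&` D).
Proof.
move=> eqw GM A mA sA.
have M1 : same_moments (fun=> 1).
  move=> s; split; last by under eq_integral do rewrite mul1r;
    under [RHS]eq_integral do rewrite mul1r; exact: eqw.
  - by apply: measurable_funM => //; apply: measurable_prod => k _; exact: mw.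
  - by exists 1 => x Dx; rewrite mul1r prod_weight_norm.
have MA : moment_stable A.
  (* [<<s G >>] is the intersection of the sigma-algebras containing [G], one of which consists of
     the stable sets. *)
  apply: sA; split => //; split.
  - exact: moment_stable0.
  - by move=> B MB; rewrite setTD; exact: moment_stableC.
  - exact: moment_stable_bigcup.
have [_ _] := MA _ M1 [::].
under eq_integral do rewrite big_nil mulr1 mul1r.
under [in RHS]eq_integral do rewrite big_nil mulr1 mul1r.
by rewrite !integral_indic.
Qed.

End moments.

(** * Expectations of products along an iid-Theta sequence *)

Lemma measurable_coordinate (R : realType) (i : nat) :
  measurable_fun [set: realseq R] (fun x : realseq R => (x : nat -> R) i).
Proof.
apply: (measurability _ (RGenOpens.measurableE R)) => _ [_ [a [b ->]] <-].
rewrite setTI; apply: sub_sigma_algebra.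
have : open (`]a, b[%classic : set R) by exact: interval_open.
have ci : continuous ((fun x => (x : nat -> R) i) : {ptws nat -> R} -> R).
  exact: (@proj_continuous nat (fun=> R) i).
exact: ((continuousP _).1 ci).
Qed.

Lemma measurable_rectangle (R : realType) (n : nat) (B : nat -> set R) :
  (forall i, measurable (B i)) ->
  measurable ([set x : nat -> R | forall i, (i < n)%N -> B i (x i)] : set (realseq R)).
Proof.
move=> mB.
rewrite (_ : mkset _ = \bigcap_i (if (i < n)%N then
    (fun x : realseq R => (x : nat -> R) i) @^-1` (B i) else setT)).
  apply: bigcap_measurable => // i _; case: ifPn => // _.
  by rewrite -[X in measurable X]setTI; exact: measurable_coordinate.
apply/seteqP; split => [x Bx i _|x Bx i lin]; first by case: ifPn => // /Bx.
by have := Bx i I; rewrite lin.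
Qed.

Lemma measurable_fine_eval (R : realType) (B : set R) : measurable B ->
  measurable_fun [set: PR R] (fun t : PR R => fine ((t : probability R R) B)).
Proof.
move=> mB; apply: measurableT_comp => //.
(* The identity map of [PR R] is a probability kernel, and evaluating a kernel at a measurable set
   is measurable. *)
exact: (measurable_kernel (kprobability (@measurable_id _ (PR R) setT))).
Qed.

Lemma prodEFin (R : numDomainType) (I : Type) (r : seq I) (f : I -> R) :
  (\prod_(i <- r) (f i)%:E = (\prod_(i <- r) f i)%:E)%E.
Proof. by elim/big_ind2 : _ => // x1 x2 y1 y2 -> ->. Qed.

Lemma iid_rectangle (R : realType) (Theta : PPR R) d (Omega : measurableType d)
    (P : probability Omega R) (X : nat -> {RV P >-> R}) (n : nat)
    (B : nat -> set R) : iid Theta X -> (forall i, measurable (B i)) ->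
  P [set w | forall i, (i < n)%N -> B i (X i w)] =
  (\int[ Theta ]_t (\prod_(i < n) fine ((t : probability R R) (B i)))%:E)%E.
Proof.
move=> [prodm prodmE PX] mB.
have := PX _ (measurable_rectangle n mB); rewrite {1}/mkset => ->.
apply: eq_integral => t _; rewrite prodmE// -prodEFin.
by apply: eq_bigr => i _; rewrite fineK// fin_num_measure.
Qed.

(** Both sides expand over words of length n in the M sets. A product of indicators is the indicator
    of a rectangle, whose probability is the integral of the product of the masses. *)
Lemma iid_simple (R : realType) (Theta : PPR R) d (Omega : measurableType d)
    (P : probability Omega R) (X : nat -> {RV P >-> R}) (n M : nat)
    (a : 'I_M -> R) (A : 'I_M -> set R) : iid Theta X ->
    (forall i, 0 <= a i) -> (forall i, measurable (A i)) ->
  (\int[P]_w (\prod_(j < n) \sum_(i < M) a i * \1_(A i) (X j w))%:E =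
   \int[ Theta ]_t ((\sum_(i < M) a i * fine ((t : probability R R) (A i))) ^+ n)%:E)%E.
Proof.
move=> iidX a0 mA.
(* Rectangles take a set for every natural index; from n on the default is the whole line. *)
pose B (f : {ffun 'I_n -> 'I_M}) (j : nat) :=
  if insub j is Some j' then A (f j') else setT.
have BE f (j : 'I_n) : B f j = A (f j) by rewrite /B valK.
have mB f j : measurable (B f j) by rewrite /B; case: insub.
pose E f : set Omega := [set w | forall j, (j < n)%N -> B f j (X j w)].
have mE f : measurable (E f).
  rewrite (_ : E f = \bigcap_j (if (j < n)%N then X j @^-1` (B f j) else setT)).
    apply: bigcap_measurable => // j _; case: ifPn => // _.
    by rewrite -[X in measurable X]setTI; exact: measurable_funP.
  apply/seteqP; split => [w Bw j _|w Bw j ljn]; first by case: ifPn => // /Bw.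
  by have := Bw j I; rewrite ljn.
pose c (f : {ffun 'I_n -> 'I_M}) := \prod_(j < n) a (f j).
have c0 f : 0 <= c f by apply: prodr_ge0.
have E1 (f : {ffun 'I_n -> 'I_M}) w : \prod_(j < n) \1_(A (f j)) (X j w) = \1_(E f) w :> R.
  rewrite indicE; have [Ew|nEw] := pselect (E f w).
    rewrite mem_set// big1// => j _; rewrite indicE mem_set// -BE.
    exact: Ew (ltn_ord j).
  have [j Aj] : exists j : 'I_n, ~ A (f j) (X j w).
    apply: contra_notP nEw => /forallNP h j ljn.
    by have /contrapT := h (Ordinal ljn); rewrite -BE.
  by rewrite memNset// (bigD1 j)//= indicE memNset// mul0r.
transitivity (\sum_f (c f)%:E * P (E f))%E.
  under eq_integral => w _.
    rewrite bigA_distr_bigA/=.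
    under eq_bigr => f _.
      rewrite big_split/= E1 -/(c f); over.
    rewrite -sumEFin; over.
  rewrite /= ge0_integral_sum//=.
  - apply: eq_bigr => f _; under eq_integral do rewrite EFinM.
    rewrite (@ge0_integralZl_EFin _ _ _ P setT measurableT
      (fun w => (\1_(E f) w)%:E))//=; first by rewrite integral_indic// setIT.
    by apply/measurable_EFinP; exact: measurable_indic.
  - by move=> f; apply/measurable_EFinP/measurable_funM.
  - by move=> f w _; rewrite lee_fin mulr_ge0.
under [RHS]eq_integral => t _.
  rewrite -[n in X in _ ^+ X]card_ord -prodr_const bigA_distr_bigA/=.
  under eq_bigr => f _ do rewrite big_split/= -/(c f).
  rewrite -sumEFin; over.
have mt (f : {ffun 'I_n -> 'I_M}) : measurable_fun [set: PR R]
   (fun t : PR R => \prod_(j < n) fine ((t : probability R R) (A (f j)))).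
  by apply: measurable_prod => j _; exact: measurable_fine_eval.
rewrite /= ge0_integral_sum//=.
- apply: eq_bigr => f _; under [RHS]eq_integral do rewrite EFinM.
  rewrite (@ge0_integralZl_EFin _ _ _ Theta setT measurableT (fun t : PR R =>
    (\prod_(j < n) fine ((t : probability R R) (A (f j))))%:E))//=.
  + rewrite (iid_rectangle n iidX (mB f)); congr (_ * _)%E.
    by apply: eq_integral => t _; congr (_%:E); apply: eq_bigr => j _; rewrite BE.
  + by move=> t _; rewrite lee_fin prodr_ge0// => j _; rewrite fine_ge0.
  + exact/measurable_EFinP.
- by move=> f; apply/measurable_EFinP/measurable_funM.
- move=> f t _; rewrite lee_fin mulr_ge0// prodr_ge0// => j _.
  by rewrite fine_ge0.
Qed.

(** A simple function is a finite combination of indicators of its level sets, so its integral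
    against t is finite, measurable in t, and covered by [iid_simple]. *)
Lemma iid_nnsfun (R : realType) (Theta : PPR R) d (Omega : measurableType d)
    (P : probability Omega R) (X : nat -> {RV P >-> R}) (n : nat)
    (h : {nnsfun R >-> R}) : iid Theta X ->
  exists z : PR R -> R, [/\ measurable_fun setT z,
    forall t : probability R R, (\int[t]_x (h x)%:E = (z t)%:E)%E &
    (\int[P]_w (\prod_(j < n) h (X j w))%:E = \int[ Theta ]_t (z t ^+ n)%:E)%E].
Proof.
move=> iidX; pose s := finmap.enum_fset (fset_set (range h)).
have hE x : h x = \sum_(i < size s) s`_i * \1_(h @^-1` [set s`_i]) x.
  exact: fimfunEord.
pose A (i : 'I_(size s)) := h @^-1` [set s`_i].
have mA i : measurable (A i).
  rewrite -[X in measurable X]setTI; exact: measurable_funP.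
have s0 (i : 'I_(size s)) : 0 <= s`_i.
  have := mem_nth 0 (ltn_ord i).
  by rewrite in_fset_set// => /set_mem[x _ <-].
exists (fun t => \sum_(i < size s) s`_i * fine ((t : probability R R) (A i))); split.
- by apply: measurable_sum => i; apply: measurable_funM => //; exact: measurable_fine_eval.
- move=> t; under eq_integral do rewrite hE -sumEFin.
  rewrite ge0_integral_sum//=; last 2 first.
  + by move=> i; apply/measurable_EFinP/measurable_funM.
  + by move=> i x _; rewrite lee_fin mulr_ge0.
  rewrite -sumEFin; apply: eq_bigr => i _.
  under eq_integral do rewrite EFinM.
  rewrite ge0_integralZl_EFin//=; last first.
    exact/measurable_EFinP/measurable_indic.
  by rewrite integral_indic// setIT EFinM fineK// fin_num_measure.
- rewrite -(iid_simple n iidX s0 mA); apply: eq_integral => w _.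
  by congr (_%:E); apply: eq_bigr => j _; rewrite hE.
Qed.

Lemma integral_full_measure d (T : measurableType d) (R : realType)
    (P : probability T R) (L : set T) (f : T -> \bar R) :
  measurable L -> P L = 1%E -> measurable_fun setT f -> (forall x, 0 <= f x)%E ->
  (\int[P]_x f x = \int[P]_(x in L) f x)%E.
Proof.
move=> mL PL mf f0; rewrite (@ge0_negligible_integral _ _ _ P setT (~` L))//.
- by rewrite setTD setCK.
- exact: measurableC.
- by have := probability_setC P mL; rewrite PL subee.
Qed.

(** Given the random law t, the variables are independent with law t. The identity passes from
    increasing simple approximations to [g] by monotone convergence on both sides. The right side is
    restricted to [L], where the integral of [g] is known to be the real number [Z t]. *)
Lemma iid_expectation (R : realType) (Theta : PPR R) d (Omega : measurableType d)
    (P : probability Omega R) (X : nat -> {RV P >-> R}) (n : nat) (g : R -> R)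
    (L : set (PR R)) (Z : PR R -> R) :
    measurable_fun setT g -> (forall x, 0 <= g x) -> measurable L ->
    Theta L = 1%E -> (forall t : probability R R, L t -> (\int[t]_x (g x)%:E = (Z t)%:E)%E) ->
    iid Theta X ->
  (\int[P]_w (\prod_(j < n) g (X j w))%:E = \int[ Theta ]_(t in L) (Z t ^+ n)%:E)%E.
Proof.
move=> mg g0 mL ThetaL LZ iidX.
have mg' : measurable_fun setT (EFin \o g) by exact/measurable_EFinP.
pose h k := nnsfun_approx measurableT mg' k.
have h_nd x : {homo (fun k => h k x) : a b / (a <= b)%N >-> a <= b}.
  by move=> a b ab; have /lefP := nd_nnsfun_approx measurableT mg' ab; exact.
have h_cvg x : h k x @[k --> \oo] --> g x.
  have : (h k x)%:E @[k --> \oo] --> (g x)%:E.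
    by apply: (cvg_nnsfun_approx measurableT mg') => // y _; rewrite lee_fin.
  by move=> /fine_cvg.
have [z zP] := choice (fun k => iid_nnsfun n (h k) iidX).
have mz k : measurable_fun setT (z k) by have [] := zP k.
have zE k (t : probability R R) : (\int[t]_x (h k x)%:E = (z k t)%:E)%E by have [] := zP k.
have z0 k (t : probability R R) : 0 <= z k t.
  by rewrite -lee_fin -zE integral_ge0// => x _; rewrite lee_fin.
have z_nd (t : probability R R) : {homo (fun k => z k t) : a b / (a <= b)%N >-> a <= b}.
  move=> a b ab; rewrite -lee_fin -!zE; apply: ge0_le_integral => //.
  - by move=> x _; rewrite lee_fin.
  - exact/measurable_EFinP.
  - exact/measurable_EFinP.
  - by move=> x _; rewrite lee_fin h_nd.
have z_cvg (t : probability R R) : L t -> z k t @[k --> \oo] --> Z t.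
  move=> Lt; suff : (z k t)%:E @[k --> \oo] --> (Z t)%:E by move=> /fine_cvg.
  rewrite -(LZ _ Lt); under eq_cvg do rewrite -zE.
  have -> : (\int[t]_x (g x)%:E = \int[t]_x limn (fun k => (h k x)%:E))%E.
    apply: eq_integral => x _; apply/esym/cvg_lim => //.
    by apply: cvg_EFin; [exact: nearW|exact: h_cvg].
  apply: cvg_monotone_convergence => //.
  - by move=> k; exact/measurable_EFinP.
  - by move=> k x _; rewrite lee_fin.
  - by move=> x _ a b ab; rewrite lee_fin h_nd.
have prod_cvg (u : nat -> nat -> R) (l : nat -> R) :
    (forall j, u k j @[k --> \oo] --> l j) ->
    (\prod_(j < n) u k j)%:E @[k --> \oo] --> (\prod_(j < n) l j)%:E.
  move=> ul; apply: cvg_EFin; first exact: nearW.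
  by apply: cvg_big => [|j _]; [exact: mul_continuous|exact: ul].
have lhs : (\int[P]_w (\prod_(j < n) h k (X j w))%:E @[k --> \oo] -->
            \int[P]_w (\prod_(j < n) g (X j w))%:E)%E.
  have -> : (\int[P]_w (\prod_(j < n) g (X j w))%:E =
             \int[P]_w limn (fun k => (\prod_(j < n) h k (X j w))%:E))%E.
    apply: eq_integral => w _; apply/esym/cvg_lim => //.
    by apply: (prod_cvg (fun k j => h k (X j w)) (fun j => g (X j w))).
  apply: cvg_monotone_convergence => //.
  - move=> k; apply/measurable_EFinP/measurable_prod => j _.
    exact: measurableT_comp.
  - by move=> k w _; rewrite lee_fin prodr_ge0.
  - by move=> w _ a b ab; rewrite lee_fin ler_prod// => j _; rewrite h_nd ?andbT//=.
have rhs : (\int[ Theta ]_(t in L) (z k t ^+ n)%:E @[k --> \oo] -->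
            \int[ Theta ]_(t in L) (Z t ^+ n)%:E)%E.
  have -> : (\int[ Theta ]_(t in L) (Z t ^+ n)%:E =
             \int[ Theta ]_(t in L) limn (fun k => (z k t ^+ n)%:E))%E.
    apply: eq_integral => t /set_mem Lt; apply/esym/cvg_lim => //.
    rewrite -[n in (Z t ^+ n)]card_ord -prodr_const.
    under eq_cvg do rewrite -[n in (_ ^+ n)]card_ord -prodr_const.
    by apply: (prod_cvg (fun k j => z k t) (fun j => Z t)) => _; exact: z_cvg.
  apply: cvg_monotone_convergence => //.
  - by move=> k; apply/measurable_EFinP/measurable_funX/measurable_funTS.
  - by move=> k t _; rewrite lee_fin exprn_ge0.
  - by move=> t _ a b ab; rewrite lee_fin lerXn2r ?nnegrE ?z_nd.
move: lhs; have -> : (fun k => \int[P]_w (\prod_(j < n) h k (X j w))%:E)%E =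
    (fun k => \int[ Theta ]_(t in L) (z k t ^+ n)%:E)%E.
  apply/funext => k; have [_ _ ->] := zP k; apply: integral_full_measure => //.
    by apply/measurable_EFinP/measurable_funX.
  by move=> t; rewrite lee_fin exprn_ge0.
by move=> /cvg_lim <-//; move: rhs => /cvg_lim <-.
Qed.

(** * Finite mixtures of laws carried by the natural numbers *)

Lemma range_natrE (R : realType) :
  range (fun n : nat => n%:R : R) = \bigcup_n [set n%:R].
Proof. by apply/seteqP; split => [_ [n _ <-]|_ [n _ ->]]; exists n. Qed.

Lemma measurable_range_natr (R : realType) :
  measurable (range (fun n : nat => n%:R : R)).
Proof. by rewrite range_natrE; exact: bigcup_measurable. Qed.

Lemma integral_nat_carried (R : realType) (mu : probability R R) (g : R -> R) :
  mu (range (fun n : nat => n%:R)) = 1%E ->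
  measurable_fun setT g -> (forall x, 0 <= g x) ->
  (\int[mu]_x (g x)%:E = \sum_(n <oo) (g n%:R)%:E * mu [set n%:R])%E.
Proof.
move=> muN mg g0.
have NE := @range_natrE R; have mN := @measurable_range_natr R.
have mg' : measurable_fun setT (EFin \o g) by exact/measurable_EFinP.
rewrite (integral_full_measure mN muN mg'); last by move=> x; rewrite lee_fin.
rewrite NE ge0_integral_bigcup//=.
- apply: eq_eseriesr => n _.
  rewrite (eq_integral (fun=> (g n%:R)%:E)) => [|x /set_mem -> //].
  by rewrite integral_cst.
- by rewrite -NE; exact: measurable_funTS.
- by move=> x _; rewrite lee_fin.
- apply/trivIsetP => i j _ _ ij; apply/seteqP; split => // x [/= -> /eqP].
  by rewrite eqr_nat (negbTE ij).
Qed.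

Lemma measure_nat_carried (R : realType) (mu : probability R R) (B : set R) :
  mu (range (fun n : nat => n%:R)) = 1%E -> measurable B ->
  (mu B = \sum_(n <oo) (\1_B n%:R)%:E * mu [set n%:R])%E.
Proof.
move=> muN mB; rewrite -integral_nat_carried ?integral_indic ?setIT//.
Qed.

(* Words f of length n stand for the multi-indices of degree n: two words with the
   same letter counts index the same monomial, hence the invariance of D. *)
Definition mgf_free (R : realType) (m : nat) (phi : 'I_m -> R -> R) :=
  forall (n : nat) (D : {ffun 'I_n -> 'I_m} -> R),
    (forall f g : {ffun 'I_n -> 'I_m}, (forall v : 'I_m -> R, \prod_i v (f i) = \prod_i v (g i)) ->
      D f = D g) ->
    (forall s, 0 <= s -> \sum_f D f * \prod_i phi (f i) s = 0) ->
  forall f, D f = 0.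

Section mixtures.
Variables (R : realType) (m : nat) (nu : 'I_m -> probability R R).
Hypothesis nuN : forall k, nu k (range (fun n : nat => n%:R)) = 1%E.

(** When this matrix is invertible, the weights of a mixture can be recovered from its masses at 0,
    ..., m - 1. *)
Definition atom_mx : 'M[R]_m := \matrix_(k, j) fine (nu k [set (j : nat)%:R]).
Hypothesis nu_free : atom_mx \in unitmx.

(** The solution of the linear system for the weights, taken for every law t so as to be a
    measurable function on the whole space; it gives mixture weights when t is a mixture. *)
Definition weight (k : 'I_m) (t : probability R R) : R :=
  (\row_(j < m) fine (t [set (j : nat)%:R]) *m invmx atom_mx) 0 k.

Lemma weightE (v : 'I_m -> R) (t : probability R R) :
  (forall B, measurable B -> t B = \sum_(k < m) (v k)%:E * nu k B)%E ->
  forall k, weight k t = v k.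
Proof.
move=> tE k; rewrite /weight (_ : \row_j _ = (\row_k v k) *m atom_mx).
  by rewrite mulmxK// mxE.
apply/rowP => j; rewrite !mxE tE//.
have -> : (\sum_(k0 < m) (v k0)%:E * nu k0 [set (j : nat)%:R] =
    (\sum_(k0 < m) v k0 * fine (nu k0 [set (j : nat)%:R]))%:E)%E.
  rewrite -sumEFin; apply: eq_bigr => i _.
  by rewrite EFinM fineK// fin_num_measure.
by apply: eq_bigr => i _; rewrite !mxE.
Qed.

Lemma convex_combination_weight (t : PR R) : convex_combination nu t ->
  [/\ forall k, 0 <= weight k t, \sum_(k < m) weight k t = 1 &
      forall B, measurable B ->
        ((t : probability R R) B = \sum_(k < m) (weight k t)%:E * nu k B)%E].
Proof.
move=> [v [v0 v1 tE]]; have wE k := weightE tE k.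
split => [k||B mB]; first by rewrite wE.
- by rewrite (eq_bigr v).
- by rewrite tE//; apply: eq_bigr => k _; rewrite wE.
Qed.

(** A law carried by the natural numbers is determined by its atoms. This replaces the unknown
    weights and the quantifier over Borel sets by countably many conditions on measurable functions
    of t, which makes the set of mixtures measurable. *)
Lemma convex_combinationP (t : PR R) : convex_combination nu t <->
  [/\ forall k, 0 <= weight k t, \sum_(k < m) weight k t = 1,
      (t : probability R R) (range (fun n : nat => n%:R)) = 1%E &
      forall n : nat, ((t : probability R R) [set n%:R] =
        \sum_(k < m) (weight k t)%:E * nu k [set n%:R])%E].
Proof.
have mN := @measurable_range_natr R.
split=> [/convex_combination_weight[w0 w1 tE]|[w0 w1 tN tE]].
  split => //; last by move=> n; exact: tE.
  rewrite tE//; under eq_bigr do rewrite nuN mule1.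
  by rewrite sumEFin w1.
exists (fun k => weight k t); split => // B mB.
rewrite measure_nat_carried//.
under eq_bigr => k _.
  rewrite (measure_nat_carried (nuN k) mB) -nneseriesZl; last first.
    by move=> n _; rewrite mule_ge0// lee_fin.
  over.
rewrite -nneseries_sum; last first.
  by move=> k n _; rewrite !mule_ge0// lee_fin.
apply: eq_eseriesr => n _; rewrite tE ge0_sume_distrr; last first.
  by move=> k _; rewrite mule_ge0// lee_fin.
by apply: eq_bigr => k _; rewrite muleCA.
Qed.

Lemma measurable_weight k : measurable_fun [set: PR R] (weight k : PR R -> R).
Proof.
have -> : weight k = fun t => \sum_(j < m) fine (t [set (j : nat)%:R]) *
    invmx atom_mx j k.
  by apply/funext => t; rewrite /weight mxE; apply: eq_bigr => j _; rewrite mxE.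
apply: measurable_sum => j; apply: measurable_funM => //.
exact: measurable_fine_eval.
Qed.

Lemma measurable_convex_combination :
  measurable (convex_combination nu : set (PR R)).
Proof.
have mN := @measurable_range_natr R.
have level (f : PR R -> R) (B : set R) : measurable_fun setT f -> measurable B ->
  measurable (f @^-1` B).
  by move=> mf mB; rewrite -[X in measurable X]setTI; exact: mf.
have fineE (t : probability R R) (B : set R) (x : R) : measurable B ->
    t B = x%:E <-> fine (t B) = x.
  by move=> mB; split => [->//|<-]; rewrite fineK// fin_num_measure.
pose ev (B : set R) (t : PR R) : R := fine ((t : probability R R) B).
pose w k : PR R -> R := weight k.
(* The four factors are the clauses of [convex_combinationP], written as preimages under real-valued
   measurable maps. *)
rewrite (_ : convex_combination nu =
    \bigcap_(k in [set: 'I_m]) (w k @^-1` `[0, +oo[)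
    `&` ((fun t => \sum_(k < m) w k t) @^-1` [set 1])
    `&` (ev (range (fun n : nat => n%:R)) @^-1` [set 1])
    `&` \bigcap_n ((fun t => ev [set n%:R] t -
        \sum_(k < m) w k t * fine (nu k [set n%:R])) @^-1` [set 0])).
  apply: measurableI; first apply: measurableI; first apply: measurableI.
  - apply: fin_bigcap_measurable => // k _.
    by apply: level => //; exact: measurable_weight.
  - apply: level => //; apply: measurable_sum => k; exact: measurable_weight.
  - by apply: level => //; exact: measurable_fine_eval.
  - apply: bigcap_measurable => // n _; apply: level => //.
    apply: measurable_funB; first exact: measurable_fine_eval.
    apply: measurable_sum => k; apply: measurable_funM => //.
    exact: measurable_weight.
have sumE (t : probability R R) n : (\sum_(k < m) (weight k t)%:E * nu k [set n%:R] =
    (\sum_(k < m) weight k t * fine (nu k [set n%:R]))%:E)%E.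
  rewrite -sumEFin; apply: eq_bigr => k _.
  by rewrite EFinM fineK// fin_num_measure.
apply/seteqP; split => t.
- move=> /convex_combinationP[w0 w1 tN tE]; split; first split; first split => //.
  + by move=> k _ /=; rewrite in_itv/= w0.
  + exact/fineE.
  + by move=> n _ /=; rewrite /ev tE sumE/= subrr.
- move=> [[[w0 w1] tN] tE]; apply/convex_combinationP; split => //.
  + by move=> k; have := w0 k I; rewrite /= in_itv/= andbT.
  + exact/fineE.
  + by move=> n; rewrite sumE; apply/fineE => //; apply/eqP; rewrite -subr_eq0; apply/eqP/(tE n I).
Qed.

End mixtures.

(** * Goodness from independence of products of generating functions *)

Section good_mixtures.
Variables (R : realType) (m : nat) (nu : 'I_m -> probability R R).
Hypothesis nuN : forall k, nu k (range (fun n : nat => n%:R)) = 1%E.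
Hypothesis nu_free : atom_mx nu \in unitmx.
Variable phi : 'I_m -> R -> R.
Hypothesis phiE : forall k (s : R), 0 <= s ->
  (\int[nu k]_x (expR (s * x))%:E = (phi k s)%:E)%E.

Let L : set (PR R) := convex_combination nu.
Let w (k : 'I_m) (t : PR R) : R := weight nu k t.

Let w01 k t : L t -> 0 <= w k t <= 1.
Proof.
move=> /(convex_combination_weight nu_free)[w0 w1 _]; apply/andP; split; first exact: w0.
by rewrite -w1 (bigD1 k)//= lerDl sumr_ge0.
Qed.

Let mw k : measurable_fun setT (w k).
Proof. exact: measurable_weight. Qed.

(** All laws involved are carried by the natural numbers, so the integrals are series over atoms,
    and nonnegative terms allow the finite and infinite sums to be exchanged. *)
Lemma mgf_convex_combination (s : R) (t : probability R R) : 0 <= s -> L t ->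
  (\int[t]_x (expR (s * x))%:E = (\sum_(k < m) w k t * phi k s)%:E)%E.
Proof.
move=> s0 /(convex_combinationP nuN nu_free)[w0 _ tN tE].
have mg : measurable_fun setT (fun x : R => expR (s * x)).
  by apply: measurableT_comp => //; exact: measurable_funM.
rewrite integral_nat_carried//.
rewrite -sumEFin.
under [RHS]eq_bigr => k _.
  rewrite EFinM -phiE// integral_nat_carried// -nneseriesZl; last first.
    by move=> n _; rewrite mule_ge0// lee_fin.
  over.
rewrite -nneseries_sum; last first.
  by move=> k n _; rewrite !mule_ge0// lee_fin ?expR_ge0//; exact: w0.
apply: eq_eseriesr => n _; rewrite tE ge0_sume_distrr; last first.
  by move=> k _; rewrite mule_ge0// lee_fin; exact: w0.
by apply: eq_bigr => k _; rewrite muleCA.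
Qed.

Definition mixed_moment (Theta : PPR R) n (f : {ffun 'I_n -> 'I_m}) : R :=
  fine (\int[ Theta ]_(t in L) (\prod_(i < n) w (f i) t)%:E)%E.

Lemma mixed_momentE (Theta : PPR R) n (f : {ffun 'I_n -> 'I_m}) :
  ((mixed_moment Theta f)%:E = \int[ Theta ]_(t in L) (\prod_(i < n) w (f i) t)%:E)%E.
Proof.
rewrite /mixed_moment fineK//.
have mL : measurable L by exact: measurable_convex_combination.
apply: integrable_fin_num => //; apply: bounded_integrable => //.
  by apply: measurable_prod => i _; exact: measurable_funTS.
exists 1 => t Lt; rewrite ger0_norm; last first.
  by apply: prodr_ge0 => i _; have /andP[] := w01 (f i) Lt.
by apply: prodr_ile1 => i _; exact: w01.
Qed.

(** The exponential of a sum is a product, so [iid_expectation] yields the n-th power of the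
    generating function of the mixture; its expansion over words separates the moments of the
    weights from the functions [phi]. *)
Lemma mgf_iid_sum (Theta : PPR R) d (Omega : measurableType d)
    (P : probability Omega R) (X : nat -> {RV P >-> R}) (n : nat) (s : R) :
  Theta L = 1%E -> iid Theta X -> 0 <= s ->
  (\int[distribution P (\sum_(j < n) X j)%R]_x (expR (s * x))%:E =
   (\sum_f mixed_moment Theta f * \prod_(i < n) phi (f i) s)%:E)%E.
Proof.
move=> ThetaL iidX s0.
have mL : measurable L by exact: measurable_convex_combination.
have mg : measurable_fun setT (fun x : R => expR (s * x)).
  by apply: measurableT_comp => //; exact: measurable_funM.
have phi0 k : 0 <= phi k s.
  by rewrite -lee_fin -phiE// integral_ge0// => x _; rewrite lee_fin expR_ge0.
rewrite ge0_integral_distribution/=; last 2 first.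
- exact/measurable_EFinP.
- by move=> x; rewrite lee_fin expR_ge0.
transitivity (\int[P]_x (\prod_(j < n) expR (s * X j x))%:E)%E.
  apply: eq_integral => x _ /=; rewrite mfun_sum mulr_sumr expR_sum//.
rewrite (iid_expectation n mg (fun x => expR_ge0 _) mL ThetaL
  (fun t => mgf_convex_combination s0) iidX).
under eq_integral => t _.
  rewrite -[n in X in _ ^+ X]card_ord -prodr_const bigA_distr_bigA/=.
  under eq_bigr => f _ do rewrite big_split/= mulrC.
  rewrite -sumEFin; over.
have mprod (f : {ffun 'I_n -> 'I_m}) :
    measurable_fun L (fun t => \prod_(i < n) w (f i) t).
  by apply: measurable_prod => i _; exact: measurable_funTS.
have prod0 (f : {ffun 'I_n -> 'I_m}) : 0 <= \prod_(i < n) phi (f i) s.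
  by apply: prodr_ge0 => i _.
have wprod0 (f : {ffun 'I_n -> 'I_m}) t : L t -> 0 <= \prod_(i < n) w (f i) t.
  by move=> Lt; apply: prodr_ge0 => i _; have /andP[] := w01 (f i) Lt.
rewrite /= ge0_integral_sum//=.
- rewrite -sumEFin; apply: eq_bigr => f _; rewrite EFinM mixed_momentE muleC.
  under eq_integral do rewrite EFinM.
  rewrite (@ge0_integralZl_EFin _ _ _ Theta L mL (fun t : PR R =>
    (\prod_(i < n) w (f i) t)%:E))//=.
  + by move=> t Lt; rewrite lee_fin wprod0.
  + exact/measurable_EFinP.
- by move=> f; apply/measurable_EFinP/measurable_funM.
- by move=> f t Lt; rewrite lee_fin mulr_ge0// wprod0.
Qed.

Theorem good_convex_combination : mgf_free phi -> good (convex_combination nu).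
Proof.
move=> free; have mL : measurable L by exact: measurable_convex_combination.
split=> // Theta1 Theta2 T1L T2L d1 Omega1 P1 X d2 Omega2 P2 Y iidX iidY XY A mA.
have eq_moment (s : seq 'I_m) :
    (\int[ Theta1 ]_(t in L) (\prod_(k <- s) w k t)%:E =
     \int[ Theta2 ]_(t in L) (\prod_(k <- s) w k t)%:E)%E.
  pose f : {ffun 'I_(size s) -> 'I_m} := [ffun i => tnth (in_tuple s) i].
  have sE t : \prod_(k <- s) w k t = \prod_(i < size s) w (f i) t.
    by rewrite big_tnth; apply: eq_bigr => i _; rewrite ffunE.
  under eq_integral do rewrite sE.
  under [RHS]eq_integral do rewrite sE.
  rewrite -!mixed_momentE; congr (_%:E); apply/eqP; rewrite -subr_eq0; apply/eqP.
  (* The laws of the sums are compared only for n >= 1; the moment of degree 0 is the mass of [L],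
     which is 1 on both sides. *)
  move: f {sE}; have [->|s0] := posnP (size s).
    move=> f; rewrite /mixed_moment !(eq_integral (cst 1%E)) => [|t _|t _].
    - by rewrite !integral_cst// !mul1e; rewrite [X in fine X]T1L [X in _ - fine X]T2L subrr.
    - by rewrite big_ord0.
    - by rewrite big_ord0.
  apply: (free _ (fun f => mixed_moment Theta1 f - mixed_moment Theta2 f)).
    move=> f g fg; rewrite /mixed_moment.
    by congr (fine _ - fine _); apply: eq_integral => t _;
      rewrite (fg (fun k => w k t)).
  move=> u u0; under eq_bigr do rewrite mulrBl.
  rewrite sumrB; apply/eqP; rewrite subr_eq0 -eqe.
  rewrite -(mgf_iid_sum _ T1L iidX u0) -(mgf_iid_sum _ T2L iidY u0); apply/eqP.
  by apply: eq_measure_integral => B mB _; exact: XY.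
have Theta_L (Theta : PPR R) (ThetaL : Theta L = 1%E) : Theta A = Theta (A `&` L).
  have mA1 : measurable_fun setT (fun t => (\1_A t)%:E : \bar R).
    by apply/measurable_EFinP; exact: measurable_indic.
  have := integral_full_measure mL ThetaL mA1.
  by rewrite !integral_indic// setIT; apply => t; rewrite lee_fin.
rewrite (Theta_L _ T1L) (Theta_L _ T2L).
have mwL k : measurable_fun L (w k) by exact: measurable_funTS.
(* It suffices to treat the generators, the sets of laws t with t B < r and r in [0, 1]. On [L] the
   mass t B is a linear form in the weights with values in [0, 1], so [same_moments_lt] applies. *)
suff stable B : @pset _ R R B -> moment_stable Theta1 Theta2 L w B.
  exact: (moments_determine mL mwL w01 eq_moment stable mA mA).
move=> [r]; rewrite /= in_itv/= => r01 [{}B mB <-] f Mf.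
pose a k := fine (nu k B).
have tB t : L t -> \sum_(k < m) a k * w k t = fine ((t : probability R R) B).
  move=> /(convex_combination_weight nu_free)[_ _ tE].
  rewrite tE// (_ : (\sum_(k < m) _)%E = (\sum_(k < m) a k * w k t)%:E)//.
  rewrite -sumEFin; apply: eq_bigr => k _.
  by rewrite muleC EFinM /a fineK// fin_num_measure.
apply: eq_same_moments (same_moments_lt mL w01 (a := a) _ r01 Mf).
  move=> t Lt; rewrite tB// indicE; congr (_ * _%:R)%R.
  have -> : (t \in mset B r) = ((t : probability R R) B < r%:E)%E.
    by apply/idP/idP; rewrite inE.
  by rewrite -[in RHS](fineK (fin_num_measure _ _ mB)) lte_fin.
move=> t Lt; rewrite tB// fine_ge0//=.
by rewrite -lee_fin fineK ?probability_le1// fin_num_measure.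
Qed.

End good_mixtures.

(** * Poisson generating functions *)

Lemma nneseries_poisson_pmf (R : realType) (lambda : R) : 0 < lambda ->
  (\sum_(n <oo) (poisson_pmf lambda n)%:E = 1)%E.
Proof.
move=> lam0.
have := probability_setT (poisson_prob lambda 0 : probability nat R).
rewrite /= /poisson_prob lam0 -nneseries_esumT//.
by move=> n; rewrite lee_fin poisson_pmf_ge0.
Qed.

(** Exponential tilting: with mu = lambda e^s, the n-th term is e^(mu - lambda) times the Poisson
    weight of parameter mu, and these weights sum to 1. *)
Lemma poisson_mgf (R : realType) (lambda s : R) : 0 < lambda ->
  (\sum_(n <oo) (expR (s * n%:R))%:E * (poisson_pmf lambda n)%:E =
   (expR (lambda * (expR s - 1)))%:E)%E.
Proof.
move=> lam0; pose mu := lambda * expR s.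
have mu0 : 0 < mu by rewrite mulr_gt0 ?expR_gt0.
transitivity (\sum_(n <oo) (expR (mu - lambda))%:E * (poisson_pmf mu n)%:E)%E.
  apply: eq_eseriesr => n _; rewrite -!EFinM; congr (_%:E).
  have muX : mu ^+ n = lambda ^+ n * expR (s * n%:R).
    by rewrite exprMn expRM_natr.
  rewrite /poisson_pmf lam0 mu0 muX !expRD !expRN.
  by field; rewrite !gt_eqF ?expR_gt0 ?ltr0n ?fact_gt0.
rewrite nneseriesZl ?nneseries_poisson_pmf ?mule1//; last first.
  by move=> n _; rewrite lee_fin poisson_pmf_ge0.
by rewrite mulrBr mulr1.
Qed.

(** For u = e^s the product along a word f is exp(lambda (p(u) - n)), where p is the sum of the X^(f
    i). Words are grouped by p; the distinct polynomials all take the value n at 1, and s >= 0 means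
    u >= 1, so [expR_poly_free] makes every group sum vanish. *)
Lemma poisson_mgf_free (R : realType) (lambda : R) (m : nat) : 0 < lambda ->
  mgf_free (fun (k : 'I_m) s => expR (lambda * (expR (s * k%:R) - 1))).
Proof.
move=> lam0 n D Dsym D0 f0.
pose p (f : {ffun 'I_n -> 'I_m}) : {poly R} := \sum_i 'X^(f i).
pose S := undup [seq p f | f : {ffun 'I_n -> 'I_m}].
pose c q := \sum_(f | p f == q) D f.
have pS f : p f \in S by rewrite mem_undup; apply: map_f; rewrite mem_enum.
have c0 : {in S, forall q, c q = 0}.
  apply: (@expR_poly_free _ lambda n%:R) => //; first exact: undup_uniq.
    move=> q; rewrite mem_undup => /mapP[f _ ->]; rewrite /p horner_sum.
    under eq_bigr do rewrite hornerXn expr1n.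
    by rewrite sumr_const card_ord.
  move=> u u1; have u0 : 0 < u by apply: lt_le_trans u1.
  transitivity (\sum_f D f * expR (lambda * (p f).[u])).
    under eq_bigr do rewrite mulr_suml big_mkcond/=.
    rewrite exchange_big/=; apply: eq_bigr => f _.
    rewrite -big_mkcond/= -big_filter (eq_filter (a2 := pred1 (p f))); last first.
      by move=> q; rewrite /= eq_sym.
    by rewrite filter_pred1_uniq ?undup_uniq// big_seq1.
  transitivity (expR (lambda * n%:R) * \sum_f D f *
      \prod_i expR (lambda * (expR (ln u * (f i)%:R) - 1))).
    rewrite mulr_sumr; apply: eq_bigr => f _; rewrite -expR_sum mulrCA -expRD.
    congr (_ * expR _); rewrite -mulr_sumr -mulrDr sumrB sumr_const card_ord.
    rewrite addrC subrK /p horner_sum; congr (_ * _); apply: eq_bigr => i _.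
    by rewrite hornerXn expRM_natr lnK.
  by rewrite D0 ?mulr0// ln_ge0.
(* Words with the same polynomial have the same letter counts, so [D] is constant on the group of
   [f0]; the group sum is a multiple of [D f0] by the size of the group, which is nonzero as [f0]
   belongs to it. *)
have := c0 _ (pS f0); rewrite /c (eq_bigr (fun=> D f0)) => [|f /eqP pf].
  rewrite sumr_const => /eqP; rewrite mulrn_eq0 => /orP[/eqP/card0_eq/(_ f0)|/eqP//].
  by move=> pf0; have : f0 \in pred0 by rewrite -pf0; exact: (eqxx (p f0)).
by apply: Dsym => v; apply: prod_of_sum_Xn pf.
Qed.

(** * Laws of the multiples of a Poisson variable *)

Section poisson_multiples.
Variables (R : realType) (lambda : R) (d : measure_display).
Variables (Omega : measurableType d) (P : probability Omega R) (T : {RV P >-> R}).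
Hypothesis T_poisson : poisson_distributed lambda T.
Let nu (k : nat) : probability R R := distribution P (k%:R \o* T).

Lemma poisson_multipleE (k : nat) (B : set R) : measurable B ->
  nu k B = poisson_prob lambda 0 [set n | B (n * k)%:R].
Proof.
move=> mB; have mBk : measurable ((fun x : R => x * k%:R) @^-1` B).
  rewrite -[X in measurable X]setTI.
  have : measurable_fun setT (fun x : R => x * k%:R) by exact: measurable_funM.
  exact.
have := T_poisson mBk; rewrite /pushforward /distribution/= /pushforward => TE.
rewrite [LHS]TE; congr (poisson_prob lambda 0 _).
by apply/seteqP; split => n /=; rewrite natrM.
Qed.

Lemma poisson_multiple_nat (k : nat) :
  nu k (range (fun n : nat => n%:R)) = 1%E.
Proof.
rewrite poisson_multipleE; last exact: measurable_range_natr.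
rewrite (_ : [set n | _] = setT); last first.
  by apply/seteqP; split => // n _; exists (n * k)%N.
exact: (probability_setT (poisson_prob lambda 0 : probability nat R)).
Qed.

Lemma poisson_multiple_mgf (k : nat) (s : R) : 0 < lambda ->
  (\int[nu k]_x (expR (s * x))%:E =
   (expR (lambda * (expR (s * k%:R) - 1)))%:E)%E.
Proof.
move=> lam0.
have mexp (r : R) : measurable_fun setT (fun x : R => expR (r * x)).
  by apply: measurableT_comp => //; exact: measurable_funM.
have me (r : R) : measurable_fun setT (fun x : R => (expR (r * x))%:E).
  by apply/measurable_EFinP; exact: mexp.
have e0 (r x : R) : (0 <= (expR (r * x))%:E)%E by rewrite lee_fin expR_ge0.
transitivity (\int[distribution P T]_x (expR (s * k%:R * x))%:E)%E.
  rewrite /nu !ge0_integral_distribution//.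
  by apply: eq_integral => x _ /=; rewrite mulrAC mulrA.
rewrite integral_nat_carried; last 3 first.
- rewrite [LHS](T_poisson (@measurable_range_natr R)).
  rewrite /pushforward (_ : _ @^-1` _ = setT); last first.
    by apply/seteqP; split => // n _; exists n.
  exact: (probability_setT (poisson_prob lambda 0 : probability nat R)).
- exact: mexp.
- by move=> x; exact: expR_ge0.
rewrite -poisson_mgf//; apply: eq_eseriesr => n _; congr (_ * _)%E.
rewrite [LHS](T_poisson (measurable_set1 _)).
rewrite /pushforward (_ : _ @^-1` _ = [set n]); last first.
  by apply/seteqP; split => [i /= /eqP|i /= -> //]; rewrite eqr_nat => /eqP.
by rewrite /poisson_prob lam0 esum_set1// lee_fin poisson_pmf_ge0.
Qed.

(** For k >= 1 the variable kT never takes the values 1, ..., k - 1, and it takes the value k with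
    probability P(T = 1) > 0, while 0T charges only 0. Apart from column 0 the matrix is thus
    triangular with nonzero diagonal. *)
Lemma poisson_multiple_unitmx (N : nat) : 0 < lambda ->
  atom_mx (fun k : 'I_N => nu k) \in unitmx.
Proof.
move=> lam0; rewrite -row_free_unit; apply/inj_row_free => v vM0.
have nuE (k j : nat) : nu k [set j%:R] =
    poisson_prob lambda 0 [set n | (n * k)%N = j].
  rewrite poisson_multipleE//; congr (poisson_prob lambda 0 _).
  by apply/seteqP; split => n /= => [/eqP|->//]; rewrite eqr_nat => /eqP.
have nu_diag (k : 'I_N) : fine (nu k [set (k : nat)%:R]) != 0.
  rewrite nuE; case: (posnP k) => [->|k0].
    rewrite (_ : mkset _ = setT); last first.
      by apply/seteqP; split => // n _ /=; rewrite muln0.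
    by rewrite (probability_setT (poisson_prob lambda 0 : probability nat R)) oner_eq0.
  rewrite (_ : mkset _ = [set 1%N]); last first.
    apply/seteqP; split => n /= => [/eqP|->]; last by rewrite mul1n.
    by rewrite -[X in _ == X]mul1n eqn_pmul2r// => /eqP.
  rewrite /poisson_prob lam0 esum_set1 ?lee_fin ?poisson_pmf_ge0//=.
  by rewrite /poisson_pmf lam0 !mulf_neq0 ?gt_eqF ?expR_gt0// invr_gt0.
have nu_lt (k j : nat) : (0 < j)%N -> (k == 0)%N || (j < k)%N -> nu k [set j%:R] = 0%E.
  move=> j0 kj; rewrite nuE (_ : mkset _ = set0) ?measure0//.
  apply/seteqP; split => // -[|n] /= nkj; first by rewrite -nkj in j0.
  move: kj; rewrite -nkj mulSn ltnNge leq_addr orbF => /eqP k0.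
  by rewrite -nkj k0 muln0 in j0.
have col (j : 'I_N) : v 0 j * fine (nu j [set (j : nat)%:R]) =
    - \sum_(k < N | k != j) v 0 k * fine (nu k [set (j : nat)%:R]).
  have /rowP/(_ j) := vM0; rewrite !mxE (bigD1 j)//= => /eqP.
  rewrite mxE addr_eq0 => /eqP ->; congr (- _).
  by apply: eq_bigr => k _; rewrite mxE.
have v0 (j : 'I_N) : (0 < j)%N -> v 0 j = 0.
  (* In column j >= 1 the rows k = 0 and k > j have entry 0, and the rows 0 < k < j have coefficient
     0 by induction, so only the diagonal term is left. *)
  have [n] := ubnP j; elim: n j => // n IH j /ltnSE jn j0.
  apply/eqP; move: (col j) => /eqP; rewrite big1 ?oppr0 => [|k kj].
    by rewrite mulf_eq0 (negbTE (nu_diag j)) orbF.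
  have [k0|k0] := posnP k; first by rewrite nu_lt ?k0 ?mulr0.
  have [jk|kj'|/val_inj jk] := ltngtP j k; last by rewrite jk eqxx in kj.
    by rewrite nu_lt ?jk ?orbT// mulr0.
  by rewrite IH ?mul0r// (leq_trans kj').
(* In column 0 all coefficients but that of row 0 are already known to vanish. *)
apply/rowP => j; rewrite mxE; have [j0|] := posnP j; last exact: v0.
apply/eqP; move: (col j) => /eqP; rewrite big1 ?oppr0 => [|k kj].
  by rewrite mulf_eq0 (negbTE (nu_diag j)) orbF.
rewrite v0 ?mul0r// lt0n; apply: contra_neq kj => k0.
by apply/val_inj; rewrite /= k0.
Qed.

(** All multiples now have the same law, so [atom_mx] is singular as soon as there are two of them.
    The same set of mixtures is therefore presented with a single component, whose matrix is the 1
    by 1 identity and whose generating function is 1. *)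
Lemma good_poisson_multiples0 (N : nat) : lambda = 0 ->
  good (convex_combination (fun k : 'I_N.+1 => nu k)).
Proof.
move=> lam0.
have nuE k B : measurable B -> nu k B = nu 0%N B.
  move=> mB; rewrite !poisson_multipleE// /poisson_prob lam0 ltxx !diracE.
  by congr ((_)%:R%:E); apply/idP/idP; rewrite !inE/= muln0.
have -> : convex_combination (fun k : 'I_N.+1 => nu k) =
    convex_combination (fun k : 'I_1 => nu k).
  have E M (u : 'I_M.+1 -> R) B : measurable B -> \sum_k u k = 1 ->
      (\sum_k (u k)%:E * nu k B = nu 0%N B)%E.
    move=> mB u1; under eq_bigr do rewrite nuE//.
    rewrite -[nu 0%N B]fineK ?fin_num_measure//.
    under eq_bigr do rewrite -EFinM.
    by rewrite sumEFin -mulr_suml u1 mul1r.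
  apply/seteqP; split => t [u [u0 u1 tE]].
    exists (fun=> 1); split => //; first by rewrite big_ord1.
    by move=> B mB; rewrite tE// !E// big_ord1.
  exists (fun k => (k == ord0)%:R); split => //.
    by rewrite (bigD1 ord0)//= big1 ?addr0// => k /negbTE ->.
  move=> B mB; rewrite tE// !E//.
  by rewrite (bigD1 ord0)//= big1 ?addr0// => k /negbTE ->.
apply: (@good_convex_combination _ _ _ _ _ (fun _ _ => 1)).
- by move=> k; exact: poisson_multiple_nat.
- rewrite (_ : atom_mx _ = 1%:M) ?unitmx1//; apply/matrixP => i j.
  rewrite !mxE !ord1 poisson_multipleE// (_ : mkset _ = setT); last first.
    by apply/seteqP; split => // n _ /=; rewrite muln0.
  by rewrite (probability_setT (poisson_prob lambda 0 : probability nat R)).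
- move=> k s _; rewrite ord1 /nu ge0_integral_distribution/=; last 2 first.
  + apply/measurable_EFinP/measurableT_comp => //; exact: measurable_funM.
  + by move=> x; rewrite lee_fin expR_ge0.
  under eq_integral do rewrite /= mulr0 mulr0 expR0.
  by rewrite integral_cst// mul1e; exact: probability_setT.
(* A one-letter alphabet has exactly one word of length n, so the relation at s = 0 reads
   [D f0 = 0]. *)
- move=> n D Dsym D0 f0; have := D0 0 (lexx _).
  rewrite (eq_bigr (fun=> D f0)) => [|f _]; last first.
    rewrite big1// mulr1.
    by apply: Dsym => v; apply: eq_bigr => i _; rewrite !ord1.
  by rewrite sumr_const card_ffun !card_ord exp1n.
Qed.

End poisson_multiples.

Unset Implicit Arguments.

Theorem proposition2p5p2 (R : realType) (lambda : R) (lambda_ge0 : 0 <= lambda)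
    (d : measure_display) (Omega : measurableType d) (P : probability Omega R)
    (T : {RV P >-> R}) (T_poisson : poisson_distributed lambda T)
    (N : nat) (N_ge1 : (1 <= N)%N) :
  good (convex_combination
    (fun k : 'I_N.+1 => distribution P (k%:R \o* T))).
Proof.
move: lambda_ge0; rewrite le_eqVlt => /predU1P[lam0|lam0].
  exact: good_poisson_multiples0 T_poisson N (esym lam0).
apply: good_convex_combination (poisson_mgf_free lam0).
- by move=> k; exact: poisson_multiple_nat T_poisson k.
- exact: poisson_multiple_unitmx T_poisson _ lam0.
- by move=> k s _; exact: poisson_multiple_mgf.
Qed.
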